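(* Let $\Gamma$ be a constraint language that is not $\varepsilon$-valid. If $\Gamma$ is essentially negative and not strictly essentially negative, or $\Gamma$ is essentially positive and not strictly essentially positive, then the $4$-ary relation (in the variables $x,y,t,f$) defined by $(x=y)\land t\land\neg f$ belongs to $\langle\Gamma\rangle_{\not\exists,\neq}$.
   Context: A logical relation of arity $k$ is a set $R\subseteq\{0,1\}^k$; a constraint is $R(x_1,\dots,x_k)$ with not necessarily distinct variables $x_i$. A constraint language is a finite set $\Gamma$ of logical relations; a $\Gamma$-formula is a (finite) conjunction of constraints over relations in $\Gamma$. $\langle\Gamma\rangle_{\not\exists,\neq}$ is the set of relations that can be expressed as a $\Gamma$-formula (neither the equality relation nor existentially quantified variables are allowed). A relation is $1$-valid ($0$-valid) if it contains the all-ones (all-zeros) tuple; essentially positive if definable by a conjunction of negative literals, positive clauses and equalities $x=y$ between variables; essentially negative if definable by a conjunction of positive literals, negative clauses and equalities between variables; strictly essentially positive (strictly essentially negative) if definable by a conjunction of literals and positive clauses (of literals and negative clauses), without equalities. A constraint language has one of these properties if all its relations have it. $\Gamma$ is $\varepsilon$-valid if it is $0$-valid or $1$-valid (or both).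
   Formalization: If Γ contains an empty relation, it is further assumed that Γ without its empty relations is not ε-valid; otherwise the claim fails, e.g. for Γ = {equality, the empty unary relation}. *)

(* Defs.v *)
From HB Require Import structures.
From mathcomp Require Import all_boot finmap.

Set Implicit Arguments.
Unset Strict Implicit.
Unset Printing Implicit Defensive.

Local Open Scope fset_scope.

Definition relation := {k : nat & {set k.-tuple bool}}.
Definition arity (R : relation) : nat := tag R.
Definition tuples (R : relation) : {set (arity R).-tuple bool} := tagged R.

Definition language := {fset relation}.

(* [Constraint s] over the relation [R] stands for R(x_(s 0), ..., x_(s (k-1)));
   the indices in [s] may repeat. *)
Record constraint (n : nat) := Constraint {
  crel : relation;
  cargs : (arity crel).-tuple 'I_n
}.

Definition satisfies (n : nat) (a : n.-tuple bool) (C : constraint n) : bool :=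
  map_tuple (tnth a) (cargs C) \in tuples (crel C).

(* A formula over n variables is the list of its conjuncts. *)
Definition is_formula (Gamma : language) (n : nat) (phi : seq (constraint n)) :=
  all (fun C => crel C \in Gamma) phi.

(* The variables of the formula are exactly the coordinates of [R]: there are
   no auxiliary variables to quantify, and equality may only be used if it
   belongs to [Gamma]. *)
Definition expressible (Gamma : language) (R : relation) : Prop :=
  exists phi : seq (constraint (arity R)),
    is_formula Gamma phi /\ tuples R = [set a | all (satisfies a) phi].

(* [Lit b i] is the literal x_i (b = true) or ~ x_i (b = false); [Clause b c]
   is the disjunction of the literals [Lit b i] for i in c. *)
Variant conjunct (n : nat) :=
  | Lit of bool & 'I_n
  | Clause of bool & seq 'I_n
  | Equal of 'I_n & 'I_n.

Definition holds (n : nat) (a : n.-tuple bool) (q : conjunct n) : bool :=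
  match q with
  | Lit b i => tnth a i == b
  | Clause b c => has (fun i => tnth a i == b) c
  | Equal i j => tnth a i == tnth a j
  end.

Definition definable (allowed : forall n, pred (conjunct n)) (R : relation) :
    Prop :=
  exists phi : seq (conjunct (arity R)),
    all (@allowed _) phi /\ tuples R = [set a | all (holds a) phi].

Definition ess_pos_conjunct (n : nat) (q : conjunct n) : bool :=
  match q with
  | Lit b _ => ~~ b
  | Clause b _ => b
  | Equal _ _ => true
  end.

Definition ess_neg_conjunct (n : nat) (q : conjunct n) : bool :=
  match q with
  | Lit b _ => b
  | Clause b _ => ~~ b
  | Equal _ _ => true
  end.

Definition strict_ess_pos_conjunct (n : nat) (q : conjunct n) : bool :=
  match q with
  | Lit _ _ => true
  | Clause b _ => b
  | Equal _ _ => false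
  end.

Definition strict_ess_neg_conjunct (n : nat) (q : conjunct n) : bool :=
  match q with
  | Lit _ _ => true
  | Clause b _ => ~~ b
  | Equal _ _ => false
  end.

Definition essentially_positive := definable ess_pos_conjunct.
Definition essentially_negative := definable ess_neg_conjunct.
Definition strictly_essentially_positive := definable strict_ess_pos_conjunct.
Definition strictly_essentially_negative := definable strict_ess_neg_conjunct.

Definition valid (b : bool) (R : relation) : Prop :=
  [tuple of nseq (arity R) b] \in tuples R.

Definition every (P : relation -> Prop) (Gamma : language) : Prop :=
  forall R, R \in Gamma -> P R.

Definition eps_valid (Gamma : language) : Prop :=
  every (valid false) Gamma \/ every (valid true) Gamma.

(* The empty relation is neither 0-valid nor 1-valid, but it only occurs in
   unsatisfiable formulas.  If all nonempty relations of [Gamma] are 0-valid, or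
   all are 1-valid, then no relation separating (1,1,1,0) from both constant
   tuples is expressible over [Gamma]; e.g. Gamma = {equality, empty set}. *)
Definition is_empty (R : relation) : bool := tuples R == set0.

Definition nonempty_part (Gamma : language) : language :=
  [fset R in Gamma | ~~ is_empty R].

(* (x = y) /\ t /\ ~ f, with coordinates in the order x, y, t, f. *)
Definition eq_true_false : relation :=
  Tagged (fun k : nat => {set k.-tuple bool})
    [set a : 4.-tuple bool |
      [&& nth false a 0 == nth false a 1, nth false a 2 & ~~ nth false a 3]].

(* Main.v *)
(** An essentially positive (negative) relation is closed under coordinatewise
    disjunction (conjunction), and this is all that is used of it.  Substituting
    t for the true and f for the false coordinates of a tuple of a nonempty
    relation that is not 0-valid, resp. not 1-valid, yields constraints whose
    conjunction is t /\ ~ f: the assignment t = 0, f = 1 would put the complement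
    of a tuple in the relation, hence by closure a constant tuple.
    A relation closed under disjunction and convex for the coordinatewise order
    is the intersection of an up-set with the down-set of its maximum, hence
    strictly essentially positive.  So some relation of the language contains
    u <= v but omits some w with u <= w <= v; substituting t where u is true, f
    where v is false, x where only u and w differ and y where only w and v
    differ excludes x = 1, y = 0 and keeps x = y.  Exchanging x and y excludes
    the other case. *)
Require Import Defs.
From mathcomp Require Import all_boot finmap.

Set Implicit Arguments.
Unset Strict Implicit.
Unset Printing Implicit Defensive.

(** * Substitution, closure, convexity and definability *)

Lemma eq_tnth_mem (k : nat) (A : {set k.-tuple bool}) (u v : k.-tuple bool) :
  tnth u =1 tnth v -> u \in A -> v \in A.
Proof. by move=> uv; rewrite (eq_from_tnth uv). Qed.

Definition substitute (R : relation) (n : nat) (s : 'I_(arity R) -> 'I_n) :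
    constraint n :=
  @Constraint n R [tuple s i | i < arity R].

Lemma satisfies_substitute (R : relation) (n : nat)
    (s : 'I_(arity R) -> 'I_n) (a : n.-tuple bool) :
  satisfies a (substitute s) = ([tuple tnth a (s i) | i < arity R] \in tuples R).
Proof.
rewrite /satisfies /=.
suff -> : map_tuple (tnth a) [tuple s i | i < arity R] =
  [tuple tnth a (s i) | i < arity R] by [].
by apply: eq_from_tnth => i; rewrite tnth_map !tnth_mktuple.
Qed.

(* Disjunction for [b = true], conjunction for [b = false]: the positive and the
   negative case are treated together, [b] being the polarity of the clauses. *)
Definition join (b : bool) (k : nat) (u v : k.-tuple bool) : k.-tuple bool :=
  [tuple if tnth u i == b then b else tnth v i | i < k].

Definition join_closed (b : bool) (R : relation) : Prop :=
  forall u v, u \in tuples R -> v \in tuples R -> join b u v \in tuples R.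

Definition below (b : bool) (k : nat) (u v : k.-tuple bool) : bool :=
  [forall i, (tnth u i == b) ==> (tnth v i == b)].

Definition convex (R : relation) : bool :=
  [forall u in tuples R, forall v in tuples R,
   forall w, below true u w && below true w v ==> (w \in tuples R)].

Lemma belowP (b : bool) (k : nat) (u v : k.-tuple bool) :
  reflect (forall i, tnth u i = b -> tnth v i = b) (below b u v).
Proof.
apply: (iffP forallP) => uv i.
  by move=> ui; apply/eqP/(implyP (uv i))/eqP.
by apply/implyP => /eqP/uv/eqP.
Qed.

Lemma below_negb (b : bool) (k : nat) (u v : k.-tuple bool) :
  below (~~ b) u v = below b v u.
Proof.
apply/belowP/belowP => uv i; have := uv i;
  by case: b {uv}; case: (tnth u i); case: (tnth v i) => // h; exfalso;
     have := h erefl.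
Qed.

(** Reversing the order only exchanges the two bounds, so convexity, though stated for one order,
    serves both polarities. *)
Lemma convex_below (b : bool) (R : relation) (u v w : (arity R).-tuple bool) :
  convex R -> u \in tuples R -> v \in tuples R ->
  below b u w -> below b w v -> w \in tuples R.
Proof.
move=> cR uR vR uw wv.
have cvx x y : x \in tuples R -> y \in tuples R ->
    below true x w -> below true w y -> w \in tuples R.
  move=> xR yR xw wy.
  move/forall_inP: cR => /(_ x xR)/forall_inP/(_ y yR)/forallP/(_ w)/implyP.
  by apply; rewrite xw wy.
case: b uw wv => uw wv; first exact: (cvx u v).
by apply: (cvx v u) => //; rewrite -below_negb.
Qed.

Lemma not_convexP (R : relation) : ~~ convex R ->
  exists u v w : (arity R).-tuple bool,
    [/\ u \in tuples R, v \in tuples R, below true u w, below true w v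
      & w \notin tuples R].
Proof.
move=> /forall_inPn[u uR] /forall_inPn[v vR] /forallPn[w].
by rewrite negb_imply => /andP[/andP[uw wv] wR]; exists u, v, w.
Qed.

Lemma definable_join_closed (b : bool) (allowed : forall n, pred (conjunct n))
    (R : relation) :
  (forall n (q : conjunct n), allowed n q ->
     match q with
     | Lit c _ => c = ~~ b
     | Clause c _ => c = b
     | Equal _ _ => True
     end) ->
  definable allowed R -> join_closed b R.
Proof.
move=> allowedP [phi [phi_ok RE]] u v; rewrite RE !inE {RE}.
elim: phi phi_ok => //= q phi IH /andP[/allowedP q_ok phi_ok].
move=> /andP[uq uphi] /andP[vq vphi]; rewrite (IH phi_ok uphi vphi) andbT.
case: q q_ok uq vq {IH} => [c i|c s|i j] /=; rewrite ?tnth_mktuple.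
- by move=> -> /eqP->; case: (b).
- move=> -> /hasP[i si ui] _.
  by apply/hasP; exists i; rewrite // tnth_mktuple ui.
- by move=> _ /eqP-> /eqP->.
Qed.

(** Take [m] with the most coordinates equal to [b]: joining [u] to it cannot add any, so [m]
    already has those of [u]. *)
Lemma join_closed_max (b : bool) (R : relation) : join_closed b R ->
  ~~ is_empty R -> exists2 m, m \in tuples R & {in tuples R, forall u, below b u m}.
Proof.
move=> jR /set0Pn[u0 u0R].
pose size_b (u : (arity R).-tuple bool) := #|[set i | tnth u i == b]|.
case: (@arg_maxnP _ u0 (mem (tuples R)) size_b u0R) => m mR max_m.
exists m => // u uR; apply/belowP => i ui; apply/eqP.
have sub : [set j | tnth m j == b] \subset [set j | tnth (join b u m) j == b].
  apply/subsetP => j; rewrite !inE tnth_mktuple => mj.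
  by case: ifP.
have := subset_leqif_card sub => -[_ eq_sub].
have le := max_m _ (jR _ _ uR mR).
have : [set j | tnth (join b u m) j == b] \subset [set j | tnth m j == b].
  by rewrite -eq_sub eqn_leq subset_leq_card.
by move=> /subsetP/(_ i); rewrite !inE tnth_mktuple ui eqxx; apply.
Qed.

(** The literals cut out the tuples below the maximum [m]. The clause of a gap [a] excludes exactly
    the tuples below [a], among them [a] itself. *)
Lemma convex_definable (b : bool) (allowed : forall n, pred (conjunct n))
    (R : relation) :
  (forall n c (i : 'I_n), allowed n (Lit c i)) ->
  (forall n (s : seq 'I_n), allowed n (Clause b s)) ->
  join_closed b R -> convex R -> definable allowed R.
Proof.
move=> okL okC jR cR; have [/eqP R0|Rn0] := boolP (is_empty R).
  (* The empty clause is false. *)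
  exists [:: Clause b [::]]; split; first by rewrite /= okC.
  by rewrite R0; apply/setP => a; rewrite !inE.
have [m mR max_m] := join_closed_max jR Rn0.
pose zeros (a : (arity R).-tuple bool) :=
  [seq i <- enum 'I_(arity R) | tnth a i == ~~ b].
pose gaps := [seq a <- enum {: (arity R).-tuple bool} |
  (a \notin tuples R) && below b a m].
exists ([seq Lit (~~ b) i | i <- zeros m] ++ [seq Clause b (zeros a) | a <- gaps]).
split.
  by rewrite all_cat !all_map; apply/andP; split; apply/allP => ? _ /=.
apply/setP => w; rewrite inE all_cat !all_map.
apply/idP/andP => [wR | [/allP lits /allP clauses]].
  split; apply/allP => /=.
    move=> i; rewrite mem_filter => /andP[mi _].
    have := belowP _ _ _ (max_m w wR) i; rewrite (eqP mi).
    by case: (tnth w i); case: (b) => // h; have := h erefl.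
  move=> a; rewrite mem_filter => /andP[/andP[aR am] _].
  (* If [w] violates the clause of [a], it lies below [a]; convexity between [w] and [m] then puts
     [a] in [R]. *)
  apply: contraR aR => /hasPn no_i; apply: (convex_below cR wR mR _ am).
  apply/belowP => i wi; apply/eqP; apply/idPn => ai.
  suff /no_i : i \in zeros a by rewrite wi eqxx.
  by rewrite mem_filter mem_enum andbT; case: (tnth a i) ai; case: (b).
have wm : below b w m.
  apply/belowP => i wi; apply/eqP; apply/idPn => mi.
  have /lits /= : i \in zeros m.
    by rewrite mem_filter mem_enum andbT; case: (tnth m i) mi; case: (b).
  by rewrite wi; case: (b).
(* Otherwise [w] is a gap and violates its own clause. *)
apply/idPn => wR.
have /clauses /= /hasP[i] : w \in gaps by rewrite mem_filter wR wm mem_enum.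
by rewrite mem_filter => /andP[/eqP-> _]; case: (b).
Qed.

Lemma not_valid_exists (Gamma : language) (c : bool) :
  ~ every (valid c) Gamma -> exists2 R, R \in Gamma & ~ valid c R.
Proof.
move=> nv; pose validb (R : relation) := [tuple of nseq (arity R) c] \in tuples R.
have [/allP all_v|/allPn[R RG Rv]] := boolP (all validb Gamma); first by case: nv.
by exists R => //; apply/negP.
Qed.

Lemma nonempty_not_valid (Gamma : language) (c : bool) :
  ~ eps_valid Gamma ->
  ((exists2 R : relation, R \in Gamma & is_empty R) ->
     ~ eps_valid (nonempty_part Gamma)) ->
  exists R, [/\ R \in Gamma, ~~ is_empty R & ~ valid c R].
Proof.
move=> neps proviso.
have [/hasP ex_empty|/hasPn no_empty] := boolP (has is_empty Gamma).
  have [|R] := @not_valid_exists (nonempty_part Gamma) c.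
    by move=> v; apply: (proviso ex_empty); case: (c) v; [right|left].
  by rewrite !inE => /andP[RG Rn0] nv; exists R.
have [|R RG nv] := @not_valid_exists Gamma c.
  by move=> v; apply: neps; case: (c) v; [right|left].
by exists R; split=> //; apply: no_empty.
Qed.

(** * Constraints over the four variables *)

Definition x_ : 'I_4 := inord 0.
Definition y_ : 'I_4 := inord 1.
Definition t_ : 'I_4 := inord 2.
Definition f_ : 'I_4 := inord 3.

Lemma in_eq_true_false (a : 4.-tuple bool) :
  (a \in tuples eq_true_false) =
  [&& tnth a x_ == tnth a y_, tnth a t_ & ~~ tnth a f_].
Proof. by rewrite inE !(tnth_nth false) !inordK. Qed.

Definition const_constraint (R : relation) (m : (arity R).-tuple bool) :
    constraint 4 :=
  substitute (fun i => if tnth m i then t_ else f_).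

Lemma const_constraint_true (R : relation) (m : (arity R).-tuple bool)
    (a : 4.-tuple bool) :
  m \in tuples R -> tnth a t_ -> ~~ tnth a f_ -> satisfies a (const_constraint m).
Proof.
move=> mR at_ af_; rewrite satisfies_substitute; apply: eq_tnth_mem mR => i.
rewrite tnth_mktuple.
by case: (tnth m i); rewrite ?at_ ?(negbTE af_).
Qed.

Lemma const_constraint_neq (R : relation) (m : (arity R).-tuple bool)
    (c : bool) (a : 4.-tuple bool) :
  ~ valid c R -> satisfies a (const_constraint m) ->
  ~~ ((tnth a t_ == c) && (tnth a f_ == c)).
Proof.
rewrite satisfies_substitute => nv sat; apply/negP => /andP[/eqP at_ /eqP af_].
apply: nv; apply: eq_tnth_mem sat => i.
by rewrite tnth_mktuple tnth_nseq; case: ifP.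
Qed.

(** With [t] false and [f] true the substituted tuple is the complement of [m], and its join with
    [m] is constantly [b]. *)
Lemma const_constraint_swap (R : relation) (m : (arity R).-tuple bool)
    (b : bool) (a : 4.-tuple bool) :
  join_closed b R -> m \in tuples R -> ~ valid b R ->
  satisfies a (const_constraint m) -> ~~ (~~ tnth a t_ && tnth a f_).
Proof.
rewrite satisfies_substitute => jR mR nv sat.
apply/negP => /andP[/negbTE at_ af_].
apply: nv; apply: eq_tnth_mem (jR _ _ mR sat) => i.
rewrite !tnth_mktuple tnth_nseq.
by case: (tnth m i); case: (b); rewrite /= ?at_ ?af_.
Qed.

Definition gap_constraint (R : relation) (u v w : (arity R).-tuple bool)
    (x y : 'I_4) : constraint 4 :=
  substitute (fun i => if tnth u i then t_ else if tnth w i then x else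
                       if tnth v i then y else f_).

(** Once [t] is true and [f] false, the substituted tuple is [v] for x = y = 1, [u] for x = y = 0,
    and the omitted [w] for x = 1, y = 0. *)
Lemma gap_constraintP (R : relation) (u v w : (arity R).-tuple bool)
    (x y : 'I_4) (a : 4.-tuple bool) :
  u \in tuples R -> v \in tuples R -> below true u w -> below true w v ->
  w \notin tuples R -> tnth a t_ -> ~~ tnth a f_ ->
  (tnth a x = tnth a y -> satisfies a (gap_constraint u v w x y)) /\
  (satisfies a (gap_constraint u v w x y) -> tnth a x -> tnth a y).
Proof.
move=> uR vR /belowP uw /belowP wv wR at_ /negbTE af_.
rewrite satisfies_substitute; split.
  move=> xy; set z := (X in X \in _).
  suff -> : z = if tnth a y then v else u by case: ifP.
  apply: eq_from_tnth => i; rewrite tnth_mktuple.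
  have := uw i; have := wv i; rewrite (fun_if (fun z => tnth z i)).
  case: (tnth u i); case: (tnth w i); case: (tnth v i) => h1 h2;
    try (by have := h1 erefl); try (by have := h2 erefl);
    by rewrite ?at_ ?af_ ?xy; case: ifP.
move=> sat ax; apply: contraR wR => /negbTE ay; apply: eq_tnth_mem sat => i.
rewrite tnth_mktuple; have := uw i.
case: (tnth u i) => [/(_ erefl)->|_] //.
by case: (tnth w i); rewrite ?ax //; case: ifP; rewrite ?ay ?af_.
Qed.

Lemma expressible_eq_true_false (Gamma : language) (b : bool) :
  every (join_closed b) Gamma ->
  (forall c, exists R, [/\ R \in Gamma, ~~ is_empty R & ~ valid c R]) ->
  (exists2 R, R \in Gamma & ~~ convex R) ->
  expressible Gamma eq_true_false.
Proof.
move=> jG nvG [R RG /not_convexP[u [v [w [uR vR uw wv wR]]]]].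
have [R1 [R1G /set0Pn[m1 m1R] nv1]] := nvG b.
have [R2 [R2G /set0Pn[m2 m2R] nv2]] := nvG (~~ b).
exists [:: const_constraint m1; const_constraint m2;
           gap_constraint u v w x_ y_; gap_constraint u v w y_ x_].
split; first by rewrite /is_formula /= R1G R2G RG.
apply/setP => a; rewrite in_eq_true_false inE /= andbT.
apply/idP/idP => [/and3P[/eqP xy at_ af_]|/and4P[s1 s2 s3 s4]].
  rewrite !const_constraint_true //=.
  have [-> //] := gap_constraintP x_ y_ uR vR uw wv wR at_ af_.
  by have [-> //] := gap_constraintP y_ x_ uR vR uw wv wR at_ af_.
(* The relation that is not [b]-valid rules out t = f = [b] and the swapped values, the other one t
   = f = [~~ b]; only t = 1, f = 0 remains. *)
have [at_ af_] : tnth a t_ /\ ~~ tnth a f_.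
  have := const_constraint_neq nv1 s1; have := const_constraint_neq nv2 s2.
  have := const_constraint_swap (jG _ R1G) m1R nv1 s1.
  by case: (tnth a t_); case: (tnth a f_); case: (b).
rewrite at_ af_ /= andbT; apply/eqP; apply/idP/idP.
  by have [_] := gap_constraintP x_ y_ uR vR uw wv wR at_ af_; apply.
by have [_] := gap_constraintP y_ x_ uR vR uw wv wR at_ af_; apply.
Qed.

Lemma not_every_definable (Gamma : language) (b : bool)
    (allowed : forall n, pred (conjunct n)) :
  (forall n c (i : 'I_n), allowed n (Lit c i)) ->
  (forall n (s : seq 'I_n), allowed n (Clause b s)) ->
  every (join_closed b) Gamma -> ~ every (definable allowed) Gamma ->
  exists2 R, R \in Gamma & ~~ convex R.
Proof.
move=> okL okC jG nd.
have [/allP cG|/allPn //] := boolP (all convex Gamma).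
by case: nd => R RG; apply: convex_definable (jG _ RG) (cG _ RG).
Qed.

Theorem lemma12 (Gamma : language)
  (not_eps : ~ eps_valid Gamma)
  (empty_proviso : (exists2 R : relation, R \in Gamma & is_empty R) ->
     ~ eps_valid (nonempty_part Gamma))
  (ess : (every essentially_negative Gamma /\
          ~ every strictly_essentially_negative Gamma) \/
         (every essentially_positive Gamma /\
          ~ every strictly_essentially_positive Gamma)) :
  expressible Gamma eq_true_false.
Proof.
have nvG c := nonempty_not_valid c not_eps empty_proviso.
case: ess => -[ess not_strict].
  have jG : every (join_closed false) Gamma.
    move=> R /ess; apply: definable_join_closed => n [[]|[]|] //.
  apply: (expressible_eq_true_false jG nvG).
  exact: not_every_definable jG not_strict.
have jG : every (join_closed true) Gamma.
  move=> R /ess; apply: definable_join_closed => n [[]|[]|] //.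
apply: (expressible_eq_true_false jG nvG).
exact: not_every_definable jG not_strict.
Qed.
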